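(* For every nonnegative integer $k$, as formal power series in $t$, $$ A_{2k+1}(t,q,-1)=(t;q)_{2k+2}\sum_{\ell\ge 0}[\ell+1]_q\,\big([\ell+1]_{q^2}\big)^k\,t^\ell . $$
   Context: $t,q,p$ are indeterminates. $\mathfrak{S}_n$ is the symmetric group on $\{1,\dots,n\}$. For $\sigma=\sigma_1\cdots\sigma_n\in\mathfrak{S}_n$ (one-line notation): $\mathrm{inv}(\sigma)=\#\{(i,j)\mid 1\le i<j\le n,\ \sigma_i>\sigma_j\}$, $\mathrm{des}(\sigma)=\#\{i\mid 1\le i\le n-1,\ \sigma_i>\sigma_{i+1}\}$, and $\mathrm{maj}(\sigma)=\sum\{i\mid 1\le i\le n-1,\ \sigma_i>\sigma_{i+1}\}$ (the sum of the descent positions). Define $$A_n(t,q,p)=\sum_{\sigma\in\mathfrak{S}_n}t^{\mathrm{des}(\sigma)}q^{\mathrm{maj}(\sigma)}p^{\mathrm{inv}(\sigma)}.$$ The $q$-ascending factorial is $(a;q)_0=1$, $(a;q)_n=(1-a)(1-aq)\cdots(1-aq^{n-1})$ for $n\ge1$. For a positive integer $n$, $[n]_q=1+q+\cdots+q^{n-1}$, and $[n]_{q^2}=1+q^2+\cdots+q^{2(n-1)}$. *)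

(* Defs.v *)
From mathcomp Require Import all_boot all_order all_fingroup all_algebra.

Set Implicit Arguments.
Unset Strict Implicit.
Unset Printing Implicit Defensive.

Import GRing.Theory.
Local Open Scope ring_scope.

(* Permutations act on 'I_n = {0, ..., n-1}: the index i : 'I_n stands for the
   position i.+1 of the one-line notation of s.  A descent at i requires that
   i.+1 is still an index, so the last position is never a descent. *)
Definition descents (n : nat) (s : 'S_n) : {set 'I_n} :=
  [set i : 'I_n | [exists j : 'I_n, (j == i.+1 :> nat) && (s j < s i)%N]].

Definition des (n : nat) (s : 'S_n) : nat := #|descents s|.

Definition maj (n : nat) (s : 'S_n) : nat := (\sum_(i in descents s) i.+1)%N.

Definition inv (n : nat) (s : 'S_n) : nat :=
  #|[set ij : 'I_n * 'I_n | (ij.1 < ij.2)%N && (s ij.2 < s ij.1)%N]|.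

(* A_n(t,q,p) in Z[q][t][p]: p is the outermost indeterminate, t the middle
   one and q the innermost one, so that (A n).[a] substitutes a for p. *)
Definition A (n : nat) : {poly {poly {poly int}}} :=
  let t := 'X%:P in
  let q := 'X%:P%:P in
  let p := 'X in
  \sum_(s : 'S_n) t ^+ des s * q ^+ maj s * p ^+ inv s.

Definition qfact (R : comNzRingType) (a q : R) (n : nat) : R :=
  \prod_(i < n) (1 - a * q ^+ i).

Definition qint (R : comNzRingType) (n : nat) (q : R) : R :=
  \sum_(i < n) q ^+ i.

(* A formal power series over R is the sequence of its coefficients: the series
   \sum_(l >= 0) c_l t^l is the function c. *)
Definition fps (R : comNzRingType) : Type := nat -> R.

Definition fps_of_poly (R : comNzRingType) (f : {poly R}) : fps R :=
  fun m => f`_m.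

Definition fps_mul (R : comNzRingType) (f g : fps R) : fps R :=
  fun m => \sum_(i < m.+1) f i * g (m - i)%N.

(* Main.v *)
Require Import Defs.
From mathcomp Require Import all_boot all_order all_fingroup all_algebra ring zify.
Import GRing.Theory.
Local Open Scope ring_scope.

Set Implicit Arguments.
Unset Strict Implicit.
Unset Printing Implicit Defensive.

(** Count pairs (s, w) of a permutation s of n letters and a word w of length n
    over {0, ..., l} such that w o s is weakly decreasing, strictly at the
    descents of s, each pair being weighted by (-1)^(inv s) q^(sum of w).

    For fixed s, removing the letters of w o s one at a time shows that the
    series in t (over l) is t^(des s) q^(maj s) / (t;q)_(n+1), up to the sign.
    For fixed w, there is exactly one such s, obtained by sorting the positions
    by decreasing letter, and inv s is the number of pairs i < j with w_i < w_j.
    Exchanging the letters of rank 2j-1 and 2j when they differ then cancels all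
    words but those made of k equal pairs and a free letter, which have sign +1
    and contribute [l+1]_q ([l+1]_(q^2))^k. *)

(** * Power series products and the factorial [(t;q)_n] *)

Section PowerSeries.

Variable R : comNzRingType.
Implicit Types (f : {poly R}) (c : fps R).

(** The coefficient at [m] only sees [c] up to [m], so series products can be computed with
    polynomials by truncating [c] beyond [m]. *)
Lemma fps_mul_poly f c m M : (m < M)%N ->
  fps_mul (fps_of_poly f) c m = (f * \poly_(l < M) c l)`_m.
Proof.
move=> ltmM; rewrite coefM; apply: eq_bigr => i _.
by rewrite coef_poly (leq_ltn_trans (leq_subr i m) ltmM).
Qed.

Definition bdiff c : fps R := fun l => c l - (if l is l'.+1 then c l' else 0).

Lemma fps_mul_1subX f c :
  fps_mul (fps_of_poly ((1 - 'X) * f)) c =1 fps_mul (fps_of_poly f) (bdiff c).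
Proof.
move=> m; rewrite (fps_mul_poly _ _ (ltnSn m)) mulrAC mulrC coefM.
apply: eq_bigr => i _; congr (_ * _).
rewrite mulrBl mul1r coefB coefXM !coef_poly ltnS leq_subr /bdiff.
by case: (m - i)%N (leq_subr i m) => //= l ltlm; rewrite ltnS ltnW.
Qed.

Lemma coef_comp_scaleX f (a : R) i : (f \Po (a *: 'X))`_i = f`_i * a ^+ i.
Proof.
rewrite coef_comp_poly; have [lt_i | le_i] := ltnP i (size f).
  rewrite (bigD1 (Ordinal lt_i)) //= big1 => [|j neq_ji].
    by rewrite exprZn coefZ coefXn eqxx mulr1 addr0.
  by rewrite exprZn coefZ coefXn eq_sym [(_ == _)%N](negPf neq_ji) !mulr0.
rewrite nth_default // mul0r big1 // => j _.
by rewrite exprZn coefZ coefXn gtn_eqF ?mulr0 // (leq_trans (ltn_ord j)).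
Qed.

(** Each remaining factor [1 - t q^(i+1)] is [1 - (q t) q^i]. *)
Lemma qfact_recl (q : R) n :
  qfact 'X q%:P n.+1 = (1 - 'X) * (qfact 'X q%:P n \Po (q *: 'X)).
Proof.
rewrite /qfact big_ord_recl expr0 mulr1 rmorph_prod; congr (_ * _).
apply: eq_bigr => i _.
rewrite rmorphB rmorph1 rmorphM rmorphXn /= comp_polyX comp_polyC.
by rewrite -mul_polyC exprS mulrCA mulrA.
Qed.

End PowerSeries.

(* Descents of [x :: u], the positions being numbered from 0, so that a leading
   [x = 0] changes neither statistic. *)
Fixpoint wdes (x : nat) (u : seq nat) : nat :=
  if u is y :: v then ((y < x) + wdes y v)%N else 0%N.

Fixpoint wmaj (x : nat) (u : seq nat) : nat :=
  if u is y :: v then (wmaj y v + wdes y v)%N else 0%N.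

(** * Words compatible with a fixed sequence *)

Section CompatibleWords.

Variables (R : comNzRingType) (q : R).

(* Generating function, by sum, of the words [a] of length [size u] such that
   [(l, x) :: zip a u] is sorted for [rle] below. *)
Fixpoint compat_gf (u : seq nat) (x l : nat) : R :=
  if u is y :: v then \sum_(b < l + (x <= y)) q ^+ b * compat_gf v y b else 1.

(** Consecutive values of [compat_gf] differ by their last summand: [b = l] when [x <= y], and
    [b = l - 1] at a descent. *)
Lemma bdiff_compat_gf y v x l :
  bdiff (compat_gf (y :: v) x) l =
    if (x <= y)%N then q ^+ l * compat_gf v y l
    else if l is l'.+1 then q ^+ l' * compat_gf v y l' else 0.
Proof.
rewrite /bdiff /=; case: (x <= y)%N; case: l => [|l].
- by rewrite big_ord1 subr0.
- by rewrite !addn1 big_ord_recr /= [X in X - _]addrC addrK.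
- by rewrite addn0 big_ord0 subr0.
- by rewrite !addn0 big_ord_recr /= [X in X - _]addrC addrK.
Qed.

(** Each factor [1 - 'X] passes to the difference of [compat_gf], which drops one letter of [u]; a
    descent there shifts the degree in [t] by one. *)
Lemma qfact_mul_compat_gf u x m :
  fps_mul (fps_of_poly (qfact 'X q%:P (size u).+1)) (compat_gf u x) m =
    (q ^+ wmaj x u) *+ (m == wdes x u).
Proof.
elim: u x m => [|y v IHv] x m.
  rewrite qfact_recl fps_mul_1subX /qfact big_ord0 rmorph1 /fps_mul /=.
  rewrite (bigD1 ord0) //= big1 => [|i /negPf i0].
    by rewrite /fps_of_poly coef1 /bdiff subn0; case: m => [|m];
      rewrite mul1r addr0 (subr0, subrr).
  by rewrite /fps_of_poly coef1 -val_eqE /= in i0 *; rewrite i0 mul0r.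
rewrite qfact_recl fps_mul_1subX /fps_mul.
under eq_bigr => i _ do
  rewrite /fps_of_poly coef_comp_scaleX bdiff_compat_gf -mulrA.
rewrite /= leqNgt; case: ltnP => /= [ltyx|leqxy].
  case: m => [|m]; first by rewrite big_ord1 !mulr0.
  rewrite big_ord_recr /= subnn !mulr0 addr0 eqSS.
  (* The powers of [q] from the rescaling of [t] and from the difference combine into [q ^+ m]. By
     induction only [m = wdes y v] survives, which is the growth of [wmaj] when a letter is
     prefixed. *)
  under eq_bigr => i _ do
    rewrite subSn -1?ltnS // [q ^+ i * _]mulrA -exprD subnKC -1?ltnS // mulrCA.
  rewrite -mulr_sumr [X in _ * X](IHv y m).
  by case: eqP => [->|_]; rewrite ?mulr0 // -exprD addnC.
under eq_bigr => i _ do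
  rewrite [q ^+ i * _]mulrA -exprD subnKC -1?ltnS // mulrCA.
rewrite -mulr_sumr [X in _ * X](IHv y m) add0n.
by case: eqP => [->|_]; rewrite ?mulr0 // -exprD addnC.
Qed.

End CompatibleWords.

Lemma big_tupleS (R : nmodType) (T : finType) n (F : n.+1.-tuple T -> R) :
  \sum_w F w = \sum_x \sum_(w : n.-tuple T) F [tuple of x :: w].
Proof.
rewrite pair_big /=.
rewrite (reindex (fun p : T * n.-tuple T => [tuple of p.1 :: p.2])) //=.
exists (fun w => (thead w, behead_tuple w)) => [[x w] _ | w _] /=.
  by congr pair; apply: val_inj.
by rewrite [RHS]tuple_eta; apply: val_inj.
Qed.

(** * Signed sums over words *)

Section WordSum.

Variables (R : comNzRingType) (q : R) (L : nat).

Definition nasc n (w : n.-tuple 'I_L) : nat :=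
  (\sum_(i < n) \sum_(j < n) ((i < j) && (tnth w i < tnth w j)))%N.

Definition wweight n (w : n.-tuple 'I_L) : nat := (\sum_(i < n) tnth w i)%N.

Definition nlarger n (x : 'I_L) (w : n.-tuple 'I_L) : nat :=
  (\sum_(i < n) (x < tnth w i))%N.

Lemma nlarger_cons n x y (w : n.-tuple 'I_L) :
  nlarger x [tuple of y :: w] = ((x < y) + nlarger x w)%N.
Proof.
rewrite /nlarger big_ord_recl tnth0; congr addn.
by apply: eq_bigr => i _; rewrite tnthS.
Qed.

Lemma wweight_cons n x (w : n.-tuple 'I_L) :
  wweight [tuple of x :: w] = (x + wweight w)%N.
Proof.
rewrite /wweight big_ord_recl tnth0; congr addn.
by apply: eq_bigr => i _; rewrite tnthS.
Qed.

Lemma nasc_cons n x (w : n.-tuple 'I_L) :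
  nasc [tuple of x :: w] = (nlarger x w + nasc w)%N.
Proof.
rewrite /nasc big_ord_recl; congr addn.
  rewrite big_ord_recl add0n; apply: eq_bigr => i _.
  by rewrite tnth0 tnthS.
apply: eq_bigr => i _; rewrite big_ord_recl add0n.
by apply: eq_bigr => j _; rewrite !tnthS.
Qed.

Definition signed_word_sum n : R :=
  \sum_(w : n.-tuple 'I_L) (-1) ^+ nasc w * q ^+ wweight w.

(* Exchanging the first two letters, when distinct, flips the sign; when they
   are equal, their contributions to the sign cancel. *)
Lemma signed_word_sumSS n :
  signed_word_sum n.+2 = qint L (q ^+ 2) * signed_word_sum n.
Proof.
pose g x (w : n.-tuple 'I_L) : R := (-1) ^+ nlarger x w * q ^+ x.
pose h (w : n.-tuple 'I_L) : R := (-1) ^+ nasc w * q ^+ wweight w.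
(* The two leading letters interact only through the sign of [x < y]; each has otherwise its own
   factor [g]. *)
have term x y (w : n.-tuple 'I_L) : (-1) ^+ nasc [tuple of x :: [tuple of y :: w]] *
    q ^+ wweight [tuple of x :: [tuple of y :: w]] =
    (-1) ^+ (x < y)%N * (g x w * g y w) * h w.
  rewrite !nasc_cons !wweight_cons nlarger_cons !exprD /g /h.
  ring.
transitivity (\sum_(w : n.-tuple 'I_L)
    (\sum_(x < L) \sum_(y < L) (-1) ^+ (x < y)%N * (g x w * g y w)) * h w).
  rewrite /signed_word_sum big_tupleS.
  under eq_bigr => x _ do rewrite big_tupleS exchange_big.
  rewrite exchange_big; apply: eq_bigr => w _.
  rewrite mulr_suml; apply: eq_bigr => x _.
  by rewrite mulr_suml; apply: eq_bigr => y _; rewrite term.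
rewrite mulr_sumr; apply: eq_bigr => w _; congr (_ * _).
pose s (x y : 'I_L) : R := (-1) ^+ (x < y)%N * (g x w * g y w).
have split_lt (x : 'I_L) : \sum_(y < L) s x y =
    s x x + \sum_(y < L | (y < x)%N) s x y + \sum_(y < L | (x < y)%N) s x y.
  rewrite (bigD1 x) //= -addrA; congr (_ + _).
  rewrite (bigID (fun y : 'I_L => (y < x)%N)) /=.
  by congr (_ + _); apply: eq_bigl => y; rewrite -val_eqE /=; case: ltngtP.
rewrite (eq_bigr _ (fun x _ => split_lt x)) !big_split /=.
(* Swapping the variables in the part [y < x] lets it cancel the part [x < y], leaving the
   diagonal. *)
rewrite (exchange_big_dep predT) //= -addrA -big_split /= [X in _ + X]big1.
  rewrite addr0 /qint; apply: eq_bigr => x _; rewrite /s ltnn mul1r /g.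
  by rewrite mulrACA -!exprD addnn -mul2n exprM sqrrN !expr1n mul1r addnn
    -muln2 mulnC exprM.
move=> x _; rewrite -big_split big1 // => y ltxy.
by rewrite /s ltxy ltnNge ltnW //= mulN1r mul1r [g y w * _]mulrC subrr.
Qed.

Lemma signed_word_sum_odd k :
  signed_word_sum (2 * k + 1) = qint L q * qint L (q ^+ 2) ^+ k.
Proof.
elim: k => [|k IHk].
  rewrite mulr1 /signed_word_sum big_tupleS; apply: eq_bigr => x _.
  rewrite (big_pred1 [tuple]) => [|w]; last by rewrite [w]tuple0.
  by rewrite nasc_cons wweight_cons /nlarger /nasc /wweight !big_ord0 mul1r addn0.
by rewrite mulnS !addSn signed_word_sumSS add0n IHk mulrCA -exprS.
Qed.

End WordSum.

(* Pairs (letter, position): decreasing letters, ties by increasing position. *)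
Definition rle (a b : nat * nat) : bool :=
  (b.1 < a.1)%N || (b.1 == a.1) && (a.2 <= b.2)%N.

Lemma rle_trans : transitive rle.
Proof. by move=> [b1 b2] [a1 a2] [c1 c2]; rewrite /rle /=; lia. Qed.

Lemma rle_anti : antisymmetric rle.
Proof.
move=> [a1 a2] [b1 b2]; rewrite /rle /= => le_ab.
by congr pair; move: le_ab; lia.
Qed.

Lemma rle_total : total rle.
Proof. by move=> [a1 a2] [b1 b2]; rewrite /rle /=; lia. Qed.

Lemma rle_refl : reflexive rle.
Proof. by move=> [a1 a2]; rewrite /rle /=; lia. Qed.

(** * The unique permutation compatible with a word *)

Section Compatibility.

Variables (L n : nat).
Implicit Types (w : n.-tuple 'I_L) (s : 'S_n).

Definition tagged w (x : 'I_n) : nat * nat := (tnth w x : nat, x : nat).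

(** The rule for ties forces [w o s] to decrease strictly at the descents of [s]. *)
Definition compat w s := sorted (relpre (tagged w) rle) (codom s).

Lemma tagged_inj w : injective (tagged w).
Proof. by move=> x y [_ /val_inj]. Qed.

Lemma perm_codom s : perm_eq (codom s) (enum 'I_n).
Proof.
apply: uniq_perm; [exact/injectiveP/perm_inj | exact: enum_uniq | move=> x].
by rewrite mem_enum; apply/codomP; exists ((s^-1)%g x); rewrite permKV.
Qed.

Lemma codom_perm_inj (s t : 'S_n) : codom s = codom t -> s = t.
Proof. by move=> /eq_in_map st; apply/permP => i; apply: st; rewrite mem_enum. Qed.

Lemma compat_exists w : exists s, compat w s.
Proof.
have /tuple_permP[s def_s] :
    perm_eq (sort (relpre (tagged w) rle) (enum 'I_n)) (ord_tuple n).
  by rewrite perm_sort val_ord_tuple.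
exists s; rewrite /compat (_ : codom s = sort (relpre (tagged w) rle) (enum 'I_n)).
  by apply: sort_sorted => x y; apply: rle_total.
by rewrite def_s; apply: eq_map => i; rewrite tnth_ord_tuple.
Qed.

(** Tags contain the position, hence are distinct and can be sorted in one way only. *)
Lemma compat_uniq w (s t : 'S_n) : compat w s -> compat w t -> s = t.
Proof.
move=> cs ct; apply: codom_perm_inj; apply: (sorted_eq _ _ cs ct).
- by move=> y x z; apply: rle_trans.
- by move=> x y /rle_anti /tagged_inj.
by rewrite (permPl (perm_codom s)) perm_sym perm_codom.
Qed.

Lemma compat_leq w s (i j : 'I_n) : compat w s -> (i <= j)%N ->
  rle (tagged w (s i)) (tagged w (s j)).
Proof.
move=> cs leij.
have nth_codom k : nth (s i) (codom s) (k : 'I_n) = s k.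
  by rewrite (nth_map k) ?size_enum_ord // nth_ord_enum.
rewrite -[X in tagged w X]nth_codom -[X in rle _ (tagged w X)]nth_codom.
apply: (sorted_leq_nth _ _ _ cs) => //.
- by move=> y x z; apply: rle_trans.
- by move=> x; apply: rle_refl.
- by rewrite inE size_codom card_ord.
by rewrite inE size_codom card_ord.
Qed.

(** Larger letters are listed first and ties in increasing order, so positions [s j < s i] form an
    inversion exactly when the letter at [s j] is the smaller one. *)
Lemma inv_compat w s : compat w s -> Defs.inv s = nasc w.
Proof.
move=> cs; rewrite /Defs.inv cardsE -sum1_card big_mkcond /=.
rewrite /nasc (reindex_inj (@perm_inj _ s)).
under [RHS]eq_bigr => i _ do rewrite (reindex_inj (@perm_inj _ s)).
rewrite exchange_big pair_big; apply: eq_bigr => -[i j] _ /=; rewrite unfold_in /=.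
have := compat_leq (i := i) (j := j) cs; have := compat_leq (i := j) (j := i) cs.
rewrite /rle /=; case: (ltngtP i j) => [ltij|ltji|/val_inj <-]; last by rewrite !ltnn.
  by move=> _ /(_ isT); case: (ltnP (s j) (s i)) => //=; lia.
by move=> /(_ isT) + _; case: (ltnP (s j) (s i)) => //=; lia.
Qed.

End Compatibility.

(** * Words compatible with a fixed permutation *)

Lemma compat_gf_tuples (R : comNzRingType) (q : R) L n (u : seq nat) x b :
    size u = n -> (b < L)%N ->
  \sum_(a : n.-tuple 'I_L | path rle (b, x) (zip (map val a) u))
    q ^+ wweight a = compat_gf q u x b.
Proof.
elim: u n x b => [|y v IHv] [|n] x b //= => [_|[size_v]] ltbL.
  rewrite (big_pred1 [tuple]) => [|a]; first by rewrite /wweight big_ord0.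
  by rewrite [a]tuple0 [RHS]eq_refl.
have le_L : (b + (x <= y) <= L)%N by lia.
rewrite (big_ord_widen L (fun c => q ^+ c * compat_gf q v y c) le_L).
rewrite big_mkcond big_tupleS [RHS]big_mkcond; apply: eq_bigr => c _ /=.
(* The next letter [c] may equal [b] only if [x <= y]. *)
have -> : rle (b, x) (c : nat, y) = (c < b + (x <= y))%N by rewrite /rle /=; lia.
case: ifP => _ /=; last by rewrite big1.
rewrite -(IHv n) // mulr_sumr [RHS]big_mkcond; apply: eq_bigr => a _.
by rewrite wweight_cons exprD.
Qed.

Lemma compat_gf_compat (R : comNzRingType) (q : R) l n (s : 'S_n) :
  \sum_(w : n.-tuple 'I_l.+1 | compat w s) q ^+ wweight w =
    compat_gf q (map val (codom s)) 0 l.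
Proof.
rewrite -(@compat_gf_tuples _ q l.+1 n) ?size_map -?enumT ?size_enum_ord //.
(* Reading words in the order of [s] turns compatibility into a path condition. *)
pose twist (t : 'S_n) (w : n.-tuple 'I_l.+1) := [tuple tnth w (t i) | i < n].
rewrite (reindex (twist (s^-1)%g)) /=; last first.
  by exists (twist s) => w _; apply: eq_from_tnth => i;
    rewrite !tnth_mktuple (permK, permKV).
have tnth_twist a i : tnth (twist (s^-1)%g a) (s i) = tnth a i.
  by rewrite tnth_mktuple permK.
apply: eq_big => [a | a _].
  rewrite /compat -sorted_map /codom /image_mem -map_comp.
  have -> : map val a = [seq val (tnth a i) | i <- enum 'I_n].
    by rewrite [in RHS](map_comp val) map_tnth_enum.
  rewrite -map_comp zip_map.
  set f := (X in map X _); set g := (X in path _ _ (map X _)).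
  have /eq_map -> : f =1 g by move=> i; rewrite /f /g /= /tagged tnth_twist.
  (* The initial pair [(l, 0)] imposes nothing: [l] is the largest letter and 0 the least
     position. *)
  case: (enum 'I_n) => //= i r; rewrite [rle (l, _) _](_ : _ = true) //.
  by rewrite /rle /=; have := ltn_ord (tnth a i); lia.
congr (_ ^+ _); rewrite /wweight (reindex_inj (@perm_inj _ s)).
by apply: eq_bigr => i _; rewrite tnth_twist.
Qed.

(** * Descent statistics of permutations and of sequences *)

Lemma wdes_sum x u :
  wdes x u = (\sum_(i < size u) (nth 0 u i < nth 0 (x :: u) i))%N.
Proof. by elim: u x => [|y v IHv] x; rewrite ?big_ord0 // big_ord_recl /= IHv. Qed.

Lemma wmaj_sum x u :
  wmaj x u = (\sum_(i < size u) (nth 0 u i < nth 0 (x :: u) i) * i)%N.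
Proof.
elim: u x => [|y v IHv] x; rewrite ?big_ord0 // big_ord_recl /= muln0 add0n.
rewrite IHv wdes_sum -big_split; apply: eq_bigr => i _ /=.
by rewrite -mulnSr.
Qed.

Lemma mem_descents n (s : 'S_n.+1) (i : 'I_n.+1) (u := map val (codom s)) :
  (i \in descents s) = (i < n)%N && (nth 0 u i.+1 < nth 0 u i)%N.
Proof.
have nth_u (j : 'I_n.+1) : nth 0%N u j = s j.
  rewrite (nth_map (s j)) ?size_codom ?card_ord // (nth_map j) ?size_enum_ord //.
  by rewrite nth_ord_enum.
rewrite inE; apply/existsP/andP => [[j /andP[/eqP def_j lts]] | [ltin lts]].
  by rewrite -def_j !nth_u lts -ltnS ltn_ord.
exists (Ordinal (ltin : i.+1 < n.+1)%N); rewrite eqxx /=.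
by rewrite -(nth_u (Ordinal _)) -nth_u.
Qed.

Lemma des_wdes n (s : 'S_n) : des s = wdes 0 (map val (codom s)).
Proof.
rewrite wdes_sum size_map size_codom card_ord /des -sum1_card.
case: n s => [|n] s; first by rewrite big_pred0 ?big_ord0 // => -[].
(* The last index is never a descent and the prefixed 0 creates none, so the two sums agree after a
   shift by one. *)
rewrite big_mkcond big_ord_recr big_ord_recl /= mem_descents ltnn addn0 add0n.
apply: eq_bigr => i _; rewrite mem_descents /= ltn_ord.
by case: (_ < _)%N.
Qed.

Lemma maj_wmaj n (s : 'S_n) : maj s = wmaj 0 (map val (codom s)).
Proof.
rewrite wmaj_sum size_map size_codom card_ord /maj.
case: n s => [|n] s; first by rewrite big_pred0 ?big_ord0 // => -[].
rewrite big_mkcond big_ord_recr big_ord_recl /= mem_descents ltnn addn0 add0n.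
apply: eq_bigr => i _; rewrite mem_descents /= ltn_ord.
by case: (_ < _)%N; rewrite ?mul1n.
Qed.

(** * Double counting and conclusion *)

Lemma signed_word_sum_compat (R : comNzRingType) (q : R) l n :
  signed_word_sum q l.+1 n =
    \sum_(s : 'S_n) (-1) ^+ Defs.inv s * compat_gf q (map val (codom s)) 0 l.
Proof.
under [RHS]eq_bigr => s _ do rewrite -compat_gf_compat mulr_sumr.
rewrite (exchange_big_dep predT) //=; apply: eq_bigr => w _.
have [s cs] := compat_exists w.
rewrite (big_pred1 s) => [|t]; first by rewrite (inv_compat cs).
by apply/idP/eqP => [ct | ->//]; apply: compat_uniq ct cs.
Qed.

Lemma coef_A_opp1 n m :
  (A n).[-1]`_m =
    \sum_(s : 'S_n) (-1) ^+ Defs.inv s * ('X ^+ maj s *+ (m == des s)).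
Proof.
rewrite /A horner_sum coef_sum; apply: eq_bigr => s _.
rewrite -!polyC_exp -polyCM hornerCM hornerXn.
have -> : 'X ^+ des s * ('X ^+ maj s)%:P * (-1) ^+ Defs.inv s =
    ((-1) ^+ Defs.inv s * 'X ^+ maj s)%:P * 'X^(des s) :> {poly {poly int}}.
  by rewrite polyCM [in RHS]polyC_exp polyCN polyC1; ring.
by rewrite coefCM coefXn -mulrA mulr_natr.
Qed.

Theorem corollary3 (k : nat) :
  fps_of_poly (A (2 * k + 1)).[-1] =1
  fps_mul
    (fps_of_poly (qfact ('X : {poly {poly int}}) ('X%:P) (2 * k + 2)))
    (fun l : nat =>
       qint (l + 1) ('X : {poly int}) * qint (l + 1) ('X ^+ 2 : {poly int}) ^+ k).
Proof.
move=> m; rewrite /fps_of_poly coef_A_opp1 /fps_mul.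
(* The coefficient at [l] is a signed word sum over [l + 1] letters, hence a sum over permutations;
   each permutation is then treated separately by [qfact_mul_compat_gf]. *)
under [RHS]eq_bigr => i _ do
  rewrite !addn1 -signed_word_sum_odd signed_word_sum_compat mulr_sumr.
rewrite exchange_big; apply: eq_bigr => s _.
rewrite des_wdes maj_wmaj -qfact_mul_compat_gf /fps_mul mulr_sumr.
rewrite size_map size_codom card_ord -addnS.
by apply: eq_bigr => i _; rewrite mulrCA.
Qed.
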